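(* Let $M=(E,\mathcal{I})$ be a matroid of rank $r$ and let $\mathbf{k}=(k_1,\dots,k_s)$ be integers with $0\le k_1<k_2<\cdots<k_s\le r$ and $s\ge 2$. Then the monotone path polytope $\mathrm{MPP}_{\mathbf{1}}(P_M^{\mathbf{k}})$ of the rank-selected independence polytope $P_M^{\mathbf{k}}$ with respect to the linear function $\mathbf{1}(x)=\sum_{e\in E}x_e$ is normally equivalent to the flag matroid polytope $\Delta(\mathcal{F}_M^{\mathbf{k}})$.
   Context: For $A\subseteq E$, $e_A=\sum_{a\in A}e_a\in\mathbb{R}^E$. The rank-selected independence polytope is $P_M^{\mathbf{k}}=\mathrm{conv}\{e_I: I\in\mathcal{I},\ |I|=k_i\text{ for some } i\}$. The flag matroid $\mathcal{F}_M^{\mathbf{k}}$ is the set of chains $I_1\subset I_2\subset\cdots\subset I_s$ of independent sets of $M$ with $|I_j|=k_j$; its polytope is $\Delta(\mathcal{F}_M^{\mathbf{k}})=\mathrm{conv}\{e_{I_1}+\cdots+e_{I_s}: (I_1\subset\cdots\subset I_s)\in\mathcal{F}_M^{\mathbf{k}}\}$. For a polytope $P\subset\mathbb{R}^d$ and a linear function $c$ not constant on $P$, let $I=\{\langle c,x\rangle:x\in P\}$; a section is a continuous map $\gamma:I\to P$ with $\langle c,\gamma(s)\rangle=s$; the monotone path polytope is $\mathrm{MPP}_c(P)=\{2\int_I\gamma(s)\,ds:\gamma \text{ a section}\}$ (a polytope, by Billera–Sturmfels). Two polytopes are normally equivalent if they have the same normal fan (equivalently, each is a weak Minkowski summand of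 the other). *)

(* Defs.v *)
From HB Require Import structures.
From mathcomp Require Import all_boot all_order all_algebra.
From mathcomp Require Import all_classical all_reals all_analysis.

Set Implicit Arguments.
Unset Strict Implicit.
Unset Printing Implicit Defensive.

Import Order.TTheory GRing.Theory Num.Theory.
Import numFieldNormedType.Exports.

Local Open Scope classical_set_scope.
Local Open Scope ring_scope.

Record matroid (E : finType) := Matroid {
  indep : {set {set E}};
  indep0 : finset.set0 \in indep;
  indep_sub : forall A B : {set E}, B \in indep -> A \subset B -> A \in indep;
  indep_aug : forall A B : {set E}, A \in indep -> B \in indep ->
    (#|A| < #|B|)%N -> exists2 x, x \in B :\: A & x |: A \in indep
}.

Definition mrank (E : finType) (M : matroid E) : nat :=
  (\max_(A in indep M) #|A|)%N.

Section Polytopes.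
Context {R : realType} {E : finType}.
Implicit Types (c x y : E -> R) (P Q F S : set (E -> R)).

Definition dot c x : R := \sum_(e : E) c e * x e.

Definition conv_hull S : set (E -> R) := smallest (@convex_set R (E -> R)) S.

Definition is_polytope P : Prop :=
  exists2 V : set (E -> R), finite_set V & P = conv_hull V.

Definition face P c : set (E -> R) :=
  [set x | P x /\ forall y, P y -> dot c y <= dot c x].

(* The linear functions maximized over P at every point of F. *)
Definition normal_cone P F : set (E -> R) := [set c | F `<=` face P c].

Definition normal_fan P : set (set (E -> R)) :=
  [set normal_cone P F | F in [set face P c | c in setT] `\ set0].

Definition normally_equivalent P Q : Prop :=
  [/\ is_polytope P, is_polytope Q & normal_fan P = normal_fan Q].

(* Only the values of [g] on the interval [dot c @` P] matter; R^E carries the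
   product topology. *)
Definition is_section c P (g : R -> E -> R) : Prop :=
  [/\ {within dot c @` P, continuous (g : R -> {ptws E -> R})},
      forall t, (dot c @` P) t -> P (g t) &
      forall t, (dot c @` P) t -> dot c (g t) = t].

Definition section_integral c P (g : R -> E -> R) : E -> R :=
  fun e => \int[lebesgue_measure]_(t in dot c @` P) g t e.

(* Only meaningful when [dot c] is not constant on the polytope [P]. *)
Definition monotone_path_polytope c P : set (E -> R) :=
  [set 2 *: section_integral c P g | g in is_section c P].

Definition ones : E -> R := fun=> 1.

Definition indicator_vec (A : {set E}) : E -> R := fun e => (e \in A)%:R.

Definition rank_selected_polytope (M : matroid E) (s : nat) (k : 'I_s -> nat) :
    set (E -> R) :=
  conv_hull [set indicator_vec A | A in
    [set A : {set E} | A \in indep M /\ exists i : 'I_s, #|A| = k i]].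

Definition flag_matroid (M : matroid E) (s : nat) (k : 'I_s -> nat) :
    set ('I_s -> {set E}) :=
  [set A | (forall i, A i \in indep M /\ #|A i| = k i) /\
           forall i j : 'I_s, (i < j)%N -> A i \subset A j].

Definition flag_matroid_polytope (M : matroid E) (s : nat) (k : 'I_s -> nat) :
    set (E -> R) :=
  conv_hull [set \sum_(i < s) indicator_vec (A i) | A in flag_matroid M k].

End Polytopes.

(* Main.v *)
(* Let [f i] be the maximal [c]-weight of an independent set of size [k i].  The
   greedy algorithm yields one flag that is [c]-maximal in every rank at once, and
   the weights along the greedy chain are concave in the rank.  Hence on each fiber
   [1(x) = t] of the rank-selected polytope, [c] is at most the piecewise linear
   interpolation of [f], and the broken line through the vertices of the greedy flag
   attains this bound.  Integrating by the trapezoidal rule, the monotone path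
   polytope is the convex hull of the vectors [\sum_i w_i e_(A_i)], for flags [A]
   and fixed positive weights [w_i]; the flag matroid polytope is the same hull with
   all weights [1].  For any positive weights the flags maximizing [c] are those
   that are [c]-maximal in every rank, so the two normal fans coincide. *)
Require Import Defs.
From mathcomp Require Import all_boot all_order all_algebra.
From mathcomp Require Import all_classical all_reals all_analysis.
From mathcomp Require Import ring lra.

Set Implicit Arguments.
Unset Strict Implicit.
Unset Printing Implicit Defensive.

Import Order.TTheory GRing.Theory Num.Theory.
Import numFieldNormedType.Exports.

Local Open Scope classical_set_scope.
Local Open Scope ring_scope.

Lemma continuous_sum {R : realType} {T : topologicalType} (I : Type)
    (r : seq I) (F : I -> T -> R) :
  (forall i, continuous (F i)) -> continuous (fun x => \sum_(i <- r) F i x).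
Proof.
by move=> cF; apply: continuous_big => //; exact: add_continuous.
Qed.

(** * Convex sets, convex hulls and separation in [R^E] *)

Section Convexity.
Context {R : realType} {E : finType}.
Implicit Types (c x y : E -> R) (S T : set (E -> R)).

Lemma dotD c x y : dot c (x + y) = dot c x + dot c y.
Proof. by rewrite /dot -big_split; apply: eq_bigr => e _; rewrite /= -mulrDr. Qed.

Lemma dotZ c (a : R) x : dot c (a *: x) = a * dot c x.
Proof. by rewrite /dot mulr_sumr; apply: eq_bigr => e _; rewrite mulrCA. Qed.

Lemma dotB c x y : dot c (x - y) = dot c x - dot c y.
Proof. by rewrite dotD -(scaleN1r y) dotZ mulN1r. Qed.

Lemma dot_sum c (I : Type) (r : seq I) (F : I -> E -> R) :
  dot c (\sum_(i <- r) F i) = \sum_(i <- r) dot c (F i).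
Proof.
elim: r => [|i r IH]; last by rewrite !big_cons dotD IH.
by rewrite !big_nil /dot big1 // => e _; rewrite mulr0.
Qed.

Lemma convex_setP T : @convex_set R (E -> R) T <->
  forall x y (t : R), T x -> T y -> 0 <= t <= 1 -> T (t *: x + (1 - t) *: y).
Proof.
split=> [cT x y t Tx Ty /andP[t0 t1]|cT x y t].
  by have := cT x y (Itv01 t0 t1); rewrite !inE => /(_ Tx Ty).
rewrite !inE => Tx Ty; apply: cT => //; apply/andP; split; first exact: ge0.
exact: le1.
Qed.

Lemma convex_conv_hull S : @convex_set R (E -> R) (conv_hull S).
Proof.
apply/convex_setP => x y t Sx Sy t01 T [cT ST].
by move/convex_setP: (cT); apply => //; [exact: Sx | exact: Sy].
Qed.

(** Induction on [n]: split off the first point with weight [t] and rescale the other weights by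
    [1 / (1 - t)]; if [1 - t = 0], they all vanish. *)
Lemma convex_comb T n (a : 'I_n -> E -> R) (l : 'I_n -> R) :
  @convex_set R (E -> R) T -> (forall i, T (a i)) -> (forall i, 0 <= l i) ->
  \sum_i l i = 1 -> T (\sum_i l i *: a i).
Proof.
move=> /convex_setP cT; elim: n a l => [|n IH] a l Ta l0 l1.
  by move: l1; rewrite big_ord0 => /eqP; rewrite eq_sym oner_eq0.
rewrite big_ord_recl.
set t := l ord0; have t0 : 0 <= t by exact: l0.
have rest : \sum_(i < n) l (lift ord0 i) = 1 - t.
  by rewrite -l1 big_ord_recl addrC addKr.
have rest0 : 0 <= 1 - t by rewrite -rest sumr_ge0.
have [t1|tn1] := eqVneq (1 - t) 0.
  rewrite big1 ?addr0.
    have -> : t = 1 by move/eqP: t1; rewrite subr_eq0 => /eqP.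
    by rewrite scale1r.
  move=> i _; have /eqP : \sum_(i < n) l (lift ord0 i) = 0 by rewrite rest.
  by rewrite psumr_eq0 // => /allP /(_ i (mem_index_enum _)) /eqP ->; rewrite scale0r.
have -> : \sum_(i < n) l (lift ord0 i) *: a (lift ord0 i) =
    (1 - t) *: \sum_(i < n) (l (lift ord0 i) / (1 - t)) *: a (lift ord0 i).
  rewrite scaler_sumr; apply: eq_bigr => i _.
  by rewrite scalerA mulrCA mulfV // mulr1.
apply: cT; [exact: Ta| |by rewrite t0 -subr_ge0].
apply: IH => [i|i|].
- exact: Ta.
- by rewrite divr_ge0.
- by rewrite -mulr_suml rest divff.
Qed.

(* A nearest point [p] of the hull satisfies [<y - p, x - p> <= 0] for all its
   points [x]; the hypothesis for [c = y - p] then forces [y = p]. *)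
Lemma conv_hull_separation S y : finite_set S ->
  (forall c, exists2 x, S x & dot c y <= dot c x) -> conv_hull S y.
Proof.
move=> /finite_seqP[s ->] Sy; pose n := size s.
pose a (i : 'I_n) : E -> R := nth 0 s i.
pose q (l : 'rV[R]_n) : E -> R := \sum_i l ord0 i *: a i.
pose d (x : E -> R) : R := \sum_e (y e - x e) ^+ 2.
(* The simplex of weights is compact and [q] maps it into the hull, so a nearest point is found by
   minimizing [d] after [q] over [A]. *)
pose A := [set v : 'rV[R]_n | forall i, 0 <= v ord0 i <= 1] `&`
  [set v : 'rV[R]_n | \sum_i v ord0 i = 1].
have cfE (i : 'I_n) : continuous (fun v : 'rV[R]_n => v ord0 i).
  by move=> v; exact: coord_continuous.
have cptA : compact A.
  apply: compact_closedI.
    by apply: (@rV_compact R n (fun=> [set` `[0, 1]%R])) => i; exact: segment_compact.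
  apply: (@preimage_closed _ _ (fun v : 'rV[R]_n => \sum_i v ord0 i) [set 1]).
    by move=> v _; exact: continuous_sum.
  exact: closed_eq.
have hullA l : A l -> conv_hull [set` s] (q l).
  move=> [l01 l1]; apply: convex_comb => // [|i|i].
  - exact: convex_conv_hull.
  - by move=> T [_ sT]; apply: sT => /=; rewrite mem_nth.
  - by have /andP[] := l01 i.
have sum1 (i : 'I_n) : \sum_j (j == i)%:R = 1 :> R.
  by rewrite (bigD1 i) //= eqxx big1 ?addr0 // => j /negPf ->.
have A0 : A !=set0.
  (* At the zero function the hypothesis merely says that [s] has a member. *)
  have [x xs _] := Sy 0; have xn : (index x s < n)%N by rewrite index_mem.
  exists (\row_i (i == Ordinal xn)%:R); split => [i|] /=.
    by rewrite mxE; case: eqP; rewrite ?lexx ?ler01.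
  by under eq_bigr do rewrite mxE; exact: sum1.
have cd : {within A, continuous (fun l => d (q l))}.
  apply: continuous_subspaceT; apply: continuous_sum => e v.
  have -> : (fun l : 'rV[R]_n => (y e - q l e) ^+ 2) =
            (fun l => (y e - \sum_i l ord0 i * a i e) ^+ 2).
    by apply/funext => l; rewrite /q fct_sumE.
  apply: (@continuous_comp _ _ _ (fun l : 'rV[R]_n => y e - \sum_i l ord0 i * a i e)
     (fun z => z ^+ 2)); last exact: exprn_continuous.
  apply: continuousB; first exact: cst_continuous.
  apply: continuous_sum => i w. exact: (cvgM (cfE i w) (cvg_cst (a i e))).
have [l /set_mem Al lmin] := compact_EVT_min A0 cptA cd.
have nearest (i : 'I_n) : dot (y - q l) (a i - q l) <= 0.
  set D := dot _ _; pose N := dot (a i - q l) (a i - q l).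
  have N0 : 0 <= N by apply: sumr_ge0 => e _; rewrite -expr2 sqr_ge0.
  (* Moving from [q l] towards [a i] by [t] changes [d] by [- 2 * t * D + t ^+ 2 * N], which
     minimality keeps nonnegative. *)
  have step t : 0 <= t <= 1 -> 2 * t * D <= t ^+ 2 * N.
    move=> /andP[t0 t1].
    pose l' : 'rV[R]_n := (1 - t) *: l + t *: \row_j (j == i)%:R.
    have l'E j : l' ord0 j = (1 - t) * l ord0 j + t * (j == i)%:R by rewrite !mxE.
    have Al' : A l'.
      case: Al => l01 l1; split => [j|] /=.
        have := l01 j; rewrite l'E => /andP[u0 u1].
        by case: (j == i); apply/andP; split; rewrite /=; nra.
      under eq_bigr do rewrite l'E.
      by rewrite big_split /= -!mulr_sumr sum1 l1; ring.
    have ql' : q l' = q l + t *: (a i - q l).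
      rewrite /q.
      under eq_bigr do rewrite l'E scalerDl -!scalerA.
      rewrite big_split /= -!scaler_sumr.
      have -> : \sum_j (j == i)%:R *: a j = a i.
        rewrite (bigD1 i) //= eqxx scale1r big1 ?addr0 // => j /negPf ->.
        by rewrite scale0r.
      by rewrite scalerBl scale1r scalerBr addrAC -addrA.
    have := lmin l' (mem_set Al').
    have -> : d (q l') = d (q l) - 2 * t * D + t ^+ 2 * N.
      rewrite ql' /d /D /N /dot !mulr_sumr -sumrB -big_split /=.
      apply: eq_bigr => e _.
      change ((y e - (q l e + t * (a i e - q l e))) ^+ 2 = (y e - q l e) ^+ 2 -
        2 * t * ((y e - q l e) * (a i e - q l e)) +
        t ^+ 2 * ((a i e - q l e) * (a i e - q l e))).
      ring.
    lra.
  rewrite leNgt; apply/negP => D0.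
  (* If [0 < D], the quadratic is negative at [t = 1] when [N <= D], and otherwise at its minimizer
     [t = D / N]. *)
  have [ND|DN] := leP N D.
    by have := step 1; rewrite ler01 lexx => /(_ isT); nra.
  have Npos : 0 < N by lra.
  have DN01 : 0 <= D / N <= 1.
    apply/andP; split; first by rewrite divr_ge0 ?ltW.
    by rewrite ler_pdivrMr // mul1r ltW.
  have := step _ DN01.
  have -> : (D / N) ^+ 2 * N = D / N * D by field; lra.
  by have : 0 < D / N * D by [rewrite mulr_gt0 // divr_gt0]; lra.
have [x xs yx] := Sy (y - q l).
have xn : (index x s < n)%N by rewrite index_mem.
have := nearest (Ordinal xn); rewrite /a /= nth_index //.
rewrite dotB => xq.
have : dot (y - q l) (y - q l) <= 0 by rewrite dotB; lra.
move=> yq0; suff -> : y = q l by exact: hullA.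
have sq0 : \sum_e (y - q l) e * (y - q l) e == 0.
  rewrite eq_le; apply/andP; split => //.
  by apply: sumr_ge0 => e _; rewrite -expr2 sqr_ge0.
apply/funext => e; move: sq0; rewrite psumr_eq0.
  move=> /allP /(_ e (mem_index_enum _)) /=; rewrite mulf_eq0 orbb.
  by rewrite !fctE subr_eq0 => /eqP.
by move=> f _; rewrite -expr2 sqr_ge0.
Qed.
End Convexity.

(** * Normal fans of hulls of indexed families *)

Section NormalFan.
Context {R : realType} {E : finType}.
Implicit Types (c x y : E -> R) (S T : set (E -> R)).

(** Maximizers are recorded by index rather than as points, so that two families over one index set
    can be compared. *)
Definition argmax_at (I : Type) (D : set I) (v : I -> E -> R) c : set I :=
  [set i | D i /\ forall j, D j -> dot c (v j) <= dot c (v i)].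

Lemma sub_conv_hull S : S `<=` conv_hull S.
Proof. by move=> x Sx T [_]; apply. Qed.

Lemma conv_hull_min S T : @convex_set R (E -> R) T -> S `<=` T ->
  conv_hull S `<=` T.
Proof. by move=> cT ST x; apply. Qed.

Lemma conv_hull_dot_le S c (m : R) :
  (forall x, S x -> dot c x <= m) -> forall x, conv_hull S x -> dot c x <= m.
Proof.
move=> Sm; apply: (@conv_hull_min S [set x | dot c x <= m]) => //.
apply/convex_setP => x y t /= xm ym /andP[t0 t1].
by rewrite dotD !dotZ; nra.
Qed.

(** A linear function attains its maximum over the hull at generators, and a point of the face of
    [c] mixes only [c]-maximal generators; so membership in the cone can be tested on indices. *)
Lemma normal_cone_conv_hull (I : Type) (D : set I) (v : I -> E -> R) c :
  argmax_at D v c !=set0 ->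
  normal_cone (conv_hull (v @` D)) (face (conv_hull (v @` D)) c) =
  [set c' | argmax_at D v c `<=` argmax_at D v c'].
Proof.
move=> [a0 [Da0 a0max]]; apply/seteqP; split => c' /= cc'.
  move=> a [Da amax]; split => // b Db.
  have : face (conv_hull (v @` D)) c (v a).
    split; first by apply: sub_conv_hull; exists a.
    by apply: conv_hull_dot_le => _ [b' Db' <-]; exact: amax.
  move=> /cc'[_]; apply; apply: sub_conv_hull; by exists b.
have [_ a0max'] : argmax_at D v c' a0 by exact: cc'.
(* The conditions below cut out a convex set, so they pass from the generators to
   the hull without writing its points as convex combinations. *)
have key x : conv_hull (v @` D) x ->
    [/\ dot c x <= dot c (v a0), dot c' x <= dot c' (v a0) &
        dot c x = dot c (v a0) -> dot c' x = dot c' (v a0)].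
  apply: (@conv_hull_min _ [set x | [/\ dot c x <= dot c (v a0),
    dot c' x <= dot c' (v a0) &
    dot c x = dot c (v a0) -> dot c' x = dot c' (v a0)]]).
    apply/convex_setP => {}x y t [x1 x2 x3] [y1 y2 y3] /andP[t0 t1] /=.
    rewrite !dotD !dotZ.
    split; [nra|nra|move=> e].
    have [t_0|tn0] := eqVneq t 0.
      by move: e; rewrite t_0 !mul0r !subr0 !mul1r !add0r.
    have [t_1|tn1] := eqVneq t 1.
      by move: e; rewrite t_1 !subrr !mul1r !mul0r !addr0.
    have {}t0 : 0 < t by rewrite lt_neqAle eq_sym tn0.
    have {}t1 : 0 < 1 - t by rewrite subr_gt0 lt_neqAle tn1.
    (* Two nonnegative gaps to the maximum of [c] add up to zero; as both weights are positive, [x]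
       and [y] each attain that maximum. *)
    have u1 : 0 <= t * (dot c (v a0) - dot c x).
      by rewrite mulr_ge0 // ?subr_ge0 // ltW.
    have u2 : 0 <= (1 - t) * (dot c (v a0) - dot c y).
      by apply: mulr_ge0; [exact: ltW|rewrite subr_ge0].
    have /eqP : t * (dot c (v a0) - dot c x) = 0 by lra.
    rewrite mulf_eq0 (gt_eqF t0) subr_eq0 => /eqP /esym /x3 ->.
    have /eqP : (1 - t) * (dot c (v a0) - dot c y) = 0 by lra.
    rewrite mulf_eq0 (gt_eqF t1) subr_eq0 => /eqP /esym /y3 ->.
    by ring.
  move=> _ [b Db <-]; split; [exact: a0max|exact: a0max'|move=> bE].
  have [] : argmax_at D v c' b; last first.
    by move=> _ bmax; apply/eqP; rewrite eq_le a0max' // bmax.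
  by apply: cc'; split => // j Dj; rewrite bE a0max.
move=> x [Px xmax].
have [x1 x2 x3] := key x Px.
have xE : dot c x = dot c (v a0).
  by apply/eqP; rewrite eq_le x1 xmax //; apply: sub_conv_hull; exists a0.
split => // y /key[_ y2 _]; by rewrite x3.
Qed.

(** The right-hand side depends on [v] only through its sets of maximizing indices, so families with
    the same maximizers have the same fan. *)
Lemma normal_fan_conv_hull (I : Type) (D : set I) (v : I -> E -> R) :
  (forall c, argmax_at D v c !=set0) ->
  normal_fan (conv_hull (v @` D)) =
  [set [set c' | argmax_at D v c `<=` argmax_at D v c'] | c in setT].
Proof.
move=> vne; rewrite /normal_fan; apply/seteqP; split => K /=.
  move=> [F [[c _ <-] _] <-]; exists c => //.
  by rewrite normal_cone_conv_hull.
move=> [c _ <-]; exists (face (conv_hull (v @` D)) c); last first.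
  by rewrite normal_cone_conv_hull.
split; first by exists c.
have [a [Da amax]] := vne c.
move=> f0; have : face (conv_hull (v @` D)) c (v a); last by rewrite f0.
split; first by apply: sub_conv_hull; exists a.
by apply: conv_hull_dot_le => _ [b Db <-]; exact: amax.
Qed.

End NormalFan.

(** * The greedy algorithm on a matroid *)

Section Greedy.
Context {R : realType} {E : finType} (M : matroid E) (c : E -> R).

Lemma dot_indicator (A : {set E}) :
  dot c (indicator_vec A) = \sum_(e in A) c e.
Proof.
rewrite /dot /indicator_vec [RHS]big_mkcond; apply: eq_bigr => e _.
by case: (e \in A); rewrite ?mulr1 ?mulr0.
Qed.

Definition max_weight (A : {set E}) : Prop :=
  A \in indep M /\ forall B, B \in indep M -> #|B| = #|A| ->
    dot c (indicator_vec B) <= dot c (indicator_vec A).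

Lemma dot_indicatorU1 (A : {set E}) x : x \notin A ->
  dot c (indicator_vec (x |: A)) = c x + dot c (indicator_vec A).
Proof. by move=> xA; rewrite !dot_indicator big_setU1. Qed.

Lemma indep_max_card : exists2 B, B \in indep M & #|B| = mrank M.
Proof.
have [|B BI BE] := @eq_bigmax_cond _ (mem (indep M)) (fun A : {set E} => #|A|).
  by apply/card_gt0P; exists finset.set0; exact: indep0.
by exists B.
Qed.

(** Exchange argument: augment [A] by some [x] of an optimal set [B] with one more element. Then
    [B :\ x] weighs at most as much as [A], so [x |: A] weighs at least as much as [B]. *)
Lemma greedy_step (A : {set E}) : max_weight A -> (#|A| < mrank M)%N ->
  exists2 x, x \notin A & max_weight (x |: A).
Proof.
move=> [AI Amax] Ar.
have [B0 B0I B0r] := indep_max_card.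
have [x0 x0B x0A] := indep_aug AI B0I (eq_ind_r (fun n => #|A| < n)%N Ar B0r).
have x0nA : x0 \notin A by move: x0B; rewrite !inE => /andP[].
pose Q (B : {set E}) := (B \in indep M) && (#|B| == #|A|.+1).
(* [x0 |: A] only witnesses that independent sets of this size exist, so that a heaviest one can be
   chosen. *)
have Q0 : Q (x0 |: A) by rewrite /Q x0A cardsU1 x0nA add1n eqxx.
have := @arg_maxP _ R _ (x0 |: A) Q (fun B => dot c (indicator_vec B)) Q0.
case=> B /andP[BI /eqP BA] Bmax.
have [x xB xA] : exists2 x, x \in B :\: A & x |: A \in indep M.
  by apply: indep_aug => //; rewrite BA.
move: xB; rewrite !inE => /andP[xnA xB].
exists x => //; split=> // B' B'I B'A.
apply: (@le_trans _ _ (dot c (indicator_vec B))).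
  by apply: Bmax; rewrite /Q B'I B'A cardsU1 xnA add1n eqxx.
have xBx : x \notin B :\ x by rewrite !inE eqxx.
rewrite -[in leLHS](finset.setD1K xB) (dot_indicatorU1 xBx) (dot_indicatorU1 xnA) lerD2l.
apply: Amax; first by apply: indep_sub BI _; exact: finset.subsetDl.
by apply/eqP; rewrite -eqSS -BA (cardsD1 x B) xB.
Qed.

Lemma greedy_chain : exists G : nat -> {set E},
  (forall k, (k <= mrank M)%N -> #|G k| = k /\ max_weight (G k)) /\
  (forall k, (k < mrank M)%N -> exists2 x, x \notin G k & G k.+1 = x |: G k).
Proof.
have /choice[next nextP] (A : {set E}) : exists B : {set E},
    max_weight A -> (#|A| < mrank M)%N ->
    max_weight B /\ exists2 x, x \notin A & B = x |: A.
  have [[Am Ar]|nA] := pselect (max_weight A /\ (#|A| < mrank M)%N).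
    have [x xA xm] := greedy_step Am Ar.
    by exists (x |: A) => _ _; split => //; exists x.
  (* A default that makes [next] total; the iteration below the rank never meets this case. *)
  by exists A => Am Ar; case: nA.
pose G k := iter k next finset.set0.
have GP k : (k <= mrank M)%N -> #|G k| = k /\ max_weight (G k).
  elim: k => [_|k IH kr].
    split; first by rewrite cards0.
    split; first exact: indep0.
    by move=> B _ /eqP; rewrite cards0 cards_eq0 => /eqP ->.
  have [Gk Gm] := IH (ltnW kr).
  have [Gm' [x xG Gx]] := nextP _ Gm (eq_ind_r (fun n => n < mrank M)%N kr Gk).
  by split => //; rewrite /G iterS -/(G k) Gx cardsU1 xG Gk.
exists G; split => // k kr.
have [Gk Gm] := GP _ (ltnW kr).
by have [_ ] := nextP _ Gm (eq_ind_r (fun n => n < mrank M)%N kr Gk).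
Qed.

Lemma chain_subset (G : nat -> {set E}) r :
  (forall k, (k < r)%N -> G k \subset G k.+1) ->
  forall p q, (p <= q <= r)%N -> G p \subset G q.
Proof.
move=> GS p q /andP[pq]; rewrite -(subnK pq); elim: (q - p)%N => [//|n IH] nr.
rewrite addSn in nr *.
by apply: fintype.subset_trans (IH (ltnW nr)) _; apply: GS.
Qed.

End Greedy.

(** * Concave sequences and slopes of their chords *)

Section Concave.
Context {R : realType} (f : nat -> R) (r : nat).
Hypothesis fconc : forall k, (k.+2 <= r)%N -> f k.+2 - f k.+1 <= f k.+1 - f k.

Let slope k := f k.+1 - f k.

Lemma concave_slope_le p q : (p <= q)%N -> (q < r)%N -> slope q <= slope p.
Proof.
move=> pq; rewrite -(subnK pq); elim: (q - p)%N => [//|n IH] nr.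
apply: le_trans (IH _); last exact: ltnW.
by apply: fconc.
Qed.

(** The increment is a sum of [n] slopes, each at least the later slope at [n + p]. *)
Lemma concave_left n p : (n + p < r)%N ->
  n%:R * slope (n + p) <= f (n + p) - f p.
Proof.
elim: n => [|n IH] nr; first by rewrite add0n subrr mul0r.
have IH1 := IH (ltnW nr).
have s1 : slope (n.+1 + p) <= slope (n + p).
  by apply: concave_slope_le => //; exact: leqnSn.
have n0 : 0 <= n.+1%:R :> R by [].
have s2 : n.+1%:R * slope (n.+1 + p) <= n.+1%:R * slope (n + p).
  exact: ler_wpM2l.
apply: le_trans s2 _; rewrite -natr1 mulrDl mul1r.
have -> : f (n.+1 + p) - f p = f (n + p) - f p + slope (n + p).
  by rewrite /slope addSn; ring.
by rewrite lerD2r.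
Qed.

Lemma concave_right n q : (n + q <= r)%N ->
  f (n + q) - f q <= n%:R * slope q.
Proof.
elim: n => [|n IH] nr; first by rewrite add0n subrr mul0r.
have IH1 := IH (ltnW nr).
have := @concave_slope_le q (n + q)%N (leq_addl _ _) nr.
by rewrite addSn -natr1 mulrDl mul1r {1}/slope; lra.
Qed.

(** Both chords are compared with the single slope at [b]. The inequality is multiplied out so that
    [a = b] and [b = d] are allowed. *)
Lemma concave_slopes a b d : (a <= b)%N -> (b <= d)%N -> (d <= r)%N ->
  (b%:R - a%:R) * (f d - f b) <= (d%:R - b%:R) * (f b - f a).
Proof.
move=> ab; rewrite leq_eqVlt => /predU1P[->|bd] dr.
  by rewrite !subrr mulr0 mul0r.
have br : (b < r)%N by exact: leq_trans bd dr.
have := @concave_left (b - a) a; rewrite subnK // => /(_ br).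
have := @concave_right (d - b) b; rewrite (subnK (ltnW bd)) => /(_ dr).
rewrite !natrB ?(ltnW bd) // => h1 h2.
have ba0 : 0 <= b%:R - a%:R :> R by rewrite subr_ge0 ler_nat.
have db0 : 0 <= d%:R - b%:R :> R by rewrite subr_ge0 ler_nat (ltnW bd).
apply: le_trans (ler_wpM2l ba0 h1) _; rewrite mulrCA.
exact: ler_wpM2l.
Qed.

End Concave.

(** * Integrals of affine functions and additivity over consecutive intervals *)

Section Integration.
Context {R : realType}.
Let mu := @lebesgue_measure R.
Implicit Types (p q u v t : R).

(** The affine function through [(p, u)] and [(q, v)], for distinct [p] and [q]; it is not
    restricted to the interval between them. *)
Definition chord p q u v t : R := u + (v - u) / (q - p) * (t - p).

Lemma chord_continuous p q u v : continuous (chord p q u v).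
Proof.
move=> t; apply: cvgD; first exact: cvg_cst.
apply: cvgM; first exact: cvg_cst.
by apply: cvgB; [exact: cvg_id|exact: cvg_cst].
Qed.

Lemma within_continuous_integrable p q (f : R -> R) :
  {within `[p, q], continuous f} -> mu.-integrable `[p, q] (EFin \o f).
Proof.
by move=> cf; apply: continuous_compact_integrable => //; exact: segment_compact.
Qed.

(** The area of a trapezoid. The factor 2 is the one in the monotone path polytope. *)
Lemma integral_chord p q u v : p < q ->
  2 * \int[mu]_(t in `[p, q]) chord p q u v t = (q - p) * (u + v).
Proof.
move=> pq; pose b := (v - u) / (q - p).
(* An antiderivative of the chord, expanded in powers of ['X]. *)
pose P : {poly R} := (u - b * p) *: 'X + (b / 2) *: 'X^2.
have qp0 : q - p != 0 by rewrite subr_eq0 gt_eqF.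
have cP x : {for x, continuous (horner P)}.
  by apply/differentiable_continuous/derivable1_diffP.
rewrite /Rintegral (@continuous_FTC2 _ _ (horner P)) //.
- by rewrite /P !hornerE /= /b; field; exact: qp0.
- by apply: continuous_subspaceT; exact: chord_continuous.
- split.
  + by move=> x _.
  + by apply: cvg_at_right_filter; exact: cP.
  + by apply: cvg_at_left_filter; exact: cP.
- move=> x _; rewrite derive1E derive_val /P !poly.derivE !hornerE /= /chord -/b.
  by field.
Qed.

Lemma integral_split (m : nat) (k : nat -> R) (f : R -> R) :
  (forall i, (i < m)%N -> k i <= k i.+1) ->
  mu.-integrable `[k 0%N, k m] (EFin \o f) ->
  \int[mu]_(t in `[k 0%N, k m]) f t =
  \sum_(i < m) \int[mu]_(t in `[k i, k i.+1]) f t.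
Proof.
elim: m => [|m IH] kk fi.
  by rewrite big_ord0 set_itv1 Rintegral_set1.
have k0m : k 0%N <= k m.
  elim: m kk {IH fi} => [//|m IH] kk.
  by apply: le_trans (kk m _) => //; apply: IH => i im; apply: kk; exact: ltnW.
have kmS := kk m (ltnSn m).
rewrite big_ord_recr /= -IH; last 2 first.
- by move=> i im; apply: kk; exact: ltnW.
- apply: integrableS fi => //; apply: subset_itvl; by rewrite bnd_simp.
have := Rintegral_itvB fi (_ : (BLeft (k 0%N) <= BRight (k m))%O)
  (_ : (BRight (k m) <= BRight (k m.+1))%O).
rewrite !bnd_simp => /(_ k0m kmS).
(* The difference of integrals lives on a half-open interval; adding its left endpoint does not
   change the integral. *)
rewrite Rintegral_itv_obnd_cbnd; first by move=> <-; rewrite addrC subrK.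
apply: integrableS fi => //.
by apply: subset_itvr; rewrite bnd_simp.
Qed.

Lemma Rintegral_sum (D : set R) (I : Type) (r : seq I) (f : I -> R -> R) :
  measurable D -> (forall i, mu.-integrable D (EFin \o f i)) ->
  \int[mu]_(t in D) (\sum_(i <- r) f i t) =
  \sum_(i <- r) \int[mu]_(t in D) f i t.
Proof.
move=> mD fi.
have si s : mu.-integrable D (EFin \o (fun t => \sum_(i <- s) f i t)).
  elim: s => [|i s IH].
    under eq_fun do rewrite big_nil.
    exact: integrable0.
  under eq_fun do rewrite big_cons.
  rewrite (_ : EFin \o _ = ((EFin \o f i) \+
    (EFin \o (fun t => (\sum_(j <- s) f j t)%R)))%E).
    exact: integrableD.
  by apply/funext => t /=; rewrite EFinD.
elim: r => [|i r IH].
  under eq_Rintegral do rewrite big_nil.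
  by rewrite big_nil Rintegral_cst // mul0r.
under eq_Rintegral do rewrite big_cons.
by rewrite big_cons RintegralD // IH.
Qed.

End Integration.

(** * Piecewise linear interpolation and the trapezoidal rule *)

Section Interpolation.
Context {R : realType} (m : nat) (k : nat -> R).
Let mu := @lebesgue_measure R.
Hypothesis k_incr : forall i, (i < m)%N -> k i < k i.+1.
Implicit Types (p q t : R) (y : nat -> R).

(** For [p < q], it rises linearly from 0 to 1 on [[p, q]] and is constant on either side. *)
Definition ramp p q t : R := Num.max 0 (Num.min 1 ((t - p) / (q - p))).

(** As a sum of ramps the interpolant is continuous term by term, with no gluing at the nodes. *)
Definition interpolation y t : R :=
  y 0%N + \sum_(i < m) (y i.+1 - y i) * ramp (k i) (k i.+1) t.

Lemma nodes_le i j : (i <= j)%N -> (j <= m)%N -> k i <= k j.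
Proof.
move=> ij; rewrite -(subnK ij); elim: (j - i)%N => [//|n IH] nm.
by apply: le_trans (IH (ltnW nm)) _; apply/ltW/k_incr.
Qed.

Lemma locate_node t : (0 < m)%N -> k 0%N <= t <= k m ->
  exists2 j, (j < m)%N & k j <= t <= k j.+1.
Proof.
elim: m => // n IH _ /andP[t0 tn].
have [tk|kt] := leP t (k n); last by exists n => //; rewrite (ltW kt).
case: n IH tk tn => [_ tk tn|n IH tk tn].
  by exists 0%N; rewrite ?t0.
have [//|j jn jt] := IH isT; first by rewrite t0.
by exists j => //; exact: ltnW.
Qed.

Lemma ramp_continuous p q : continuous (ramp p q).
Proof.
pose f t := (t - p) / (q - p).
have cf : continuous f.
  move=> t; apply: cvgM; last exact: cvg_cst.
  by apply: cvgB; [exact: cvg_id|exact: cvg_cst].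
move=> t; apply: (@continuous_max _ _ (cst 0) (cst 1 \min f)).
  exact: cst_continuous.
apply: (@continuous_min _ _ (cst 1) f); first exact: cst_continuous.
exact: cf.
Qed.

Lemma interpolation_continuous y : continuous (interpolation y).
Proof.
move=> t; apply: cvgD; first exact: cvg_cst.
move: t; apply: continuous_sum => i t.
by apply: cvgM; [exact: cvg_cst|exact: ramp_continuous].
Qed.

(** On this interval the earlier ramps equal 1 and their terms telescope to [y j - y 0], the later
    ramps vanish, and only the ramp of index [j] varies. *)
Lemma interpolation_chord y j t : (j < m)%N -> k j <= t <= k j.+1 ->
  interpolation y t = chord (k j) (k j.+1) (y j) (y j.+1) t.
Proof.
move=> jm /andP[jt tj].
have d i : (i < m)%N -> 0 < k i.+1 - k i by move=> im; rewrite subr_gt0 k_incr.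
rewrite /interpolation -(big_mkord xpredT
  (fun i => (y i.+1 - y i) * ramp (k i) (k i.+1) t)).
rewrite (big_cat_nat (n := j)) //=; last exact: ltnW.
rewrite (eq_big_nat _ _ (F2 := fun i => y i.+1 - y i)); last first.
  move=> i /andP[_ ij]; rewrite /ramp.
  have im : (i < m)%N by exact: ltn_trans ij jm.
  have it : k i.+1 <= t by apply: le_trans jt; apply: nodes_le => //; exact: ltnW.
  rewrite min_l; first by rewrite max_r ?mulr1.
  by rewrite ler_pdivlMr ?d // mul1r lerD2r.
rewrite telescope_sumr // big_ltn // [X in _ + (_ + X)]big_nat big1; last first.
  move=> i /andP[ji im]; rewrite /ramp max_l ?mulr0 //.
  rewrite ge_min; apply/orP; right.
  rewrite pmulr_lle0 ?invr_gt0 ?d // subr_le0.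
  by apply: le_trans tj _; apply: nodes_le => //; exact: ltnW.
rewrite addr0 /ramp min_r; last first.
  by rewrite ler_pdivrMr ?d // mul1r lerD2r.
rewrite max_r; last by rewrite divr_ge0 ?subr_ge0 // ltW // k_incr.
rewrite /chord; field.
by rewrite gt_eqF // d.
Qed.

(** This bounds an arbitrary section; [integral_interpolation] is the matching equality for broken
    lines. *)
Lemma integral_le_nodes (h : R -> R) y :
  mu.-integrable `[k 0%N, k m] (EFin \o h) ->
  (forall j t, (j < m)%N -> k j <= t <= k j.+1 ->
    h t <= chord (k j) (k j.+1) (y j) (y j.+1) t) ->
  2 * \int[mu]_(t in `[k 0%N, k m]) h t <=
  \sum_(i < m) (k i.+1 - k i) * (y i + y i.+1).
Proof.
move=> ih hle; rewrite (integral_split _ ih) => [|i im]; last exact/ltW/k_incr.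
rewrite mulr_sumr; apply: ler_sum => i _.
rewrite -integral_chord ?k_incr // ler_pM2l //.
apply: le_Rintegral => //.
- apply: integrableS ih => //.
  by apply: subset_itv; rewrite bnd_simp; apply: nodes_le => //; exact: ltnW.
- apply: within_continuous_integrable; apply: continuous_subspaceT.
  exact: chord_continuous.
- by move=> t; rewrite /= in_itv /= => tk; exact: hle.
Qed.

Lemma integral_interpolation y :
  2 * \int[mu]_(t in `[k 0%N, k m]) interpolation y t =
  \sum_(i < m) (k i.+1 - k i) * (y i + y i.+1).
Proof.
have ii : mu.-integrable `[k 0%N, k m] (EFin \o interpolation y).
  apply: within_continuous_integrable; apply: continuous_subspaceT.
  exact: interpolation_continuous.
rewrite (integral_split _ ii) => [|i im]; last exact/ltW/k_incr.
rewrite mulr_sumr; apply: eq_bigr => i _.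
rewrite -integral_chord ?k_incr //; congr (_ * _).
apply: eq_Rintegral => t; rewrite inE /= in_itv /= => tk.
exact: interpolation_chord.
Qed.

(* The total length of the intervals adjacent to node [i]: the coefficient of [y i]
   in the trapezoidal rule. *)
Definition node_weight (i : nat) : R :=
  (if (i < m)%N then k i.+1 - k i else 0) +
  (if i is j.+1 then k j.+1 - k j else 0).

Lemma node_weightE y :
  \sum_(i < m) (k i.+1 - k i) * (y i + y i.+1) =
  \sum_(i < m.+1) node_weight i * y i.
Proof.
under eq_bigr do rewrite mulrDr.
under [RHS]eq_bigr do rewrite mulrDl.
rewrite !big_split /=; congr (_ + _).
  (* The last node has no interval to its right and, below, the first has none to its left. *)
  rewrite big_ord_recr /= ltnn mul0r addr0.
  by apply: eq_bigr => i _; rewrite ltn_ord.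
by rewrite [RHS]big_ord_recl /= mul0r add0r.
Qed.

(** With [0 < m] every node bounds an interval of positive length. Positivity is what makes the
    exact weights immaterial for the normal fan. *)
Lemma node_weight_gt0 i : (0 < m)%N -> (i <= m)%N -> 0 < node_weight i.
Proof.
move=> m0 im; rewrite /node_weight; case: ltnP => [ltim|leim].
  apply: ltr_wpDr; last by rewrite subr_gt0 k_incr.
  by case: i {ltim} im => // j jm; rewrite subr_ge0 ltW // k_incr.
rewrite add0r; case: i im {leim} (leq_trans m0 leim) => // j jm _.
by rewrite subr_gt0 k_incr.
Qed.

End Interpolation.

(** * Weighted sums of indicator vectors along flags *)

Section FlagVectors.
Context {R : realType} {E : finType} (M : matroid E) (s : nat) (k : 'I_s -> nat).
Implicit Types (c x y : E -> R) (w : 'I_s -> R) (A B : 'I_s -> {set E}).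

(** Weights 1 give the generators of the flag matroid polytope, node weights those of the monotone
    path polytope. *)
Definition flag_vector w A : E -> R := \sum_i w i *: indicator_vec (A i).

Lemma dot_flag_vector c w A :
  dot c (flag_vector w A) = \sum_i w i * dot c (indicator_vec (A i)).
Proof. by rewrite dot_sum; apply: eq_bigr => i _; rewrite dotZ. Qed.

Lemma finite_flag_matroid : finite_set (flag_matroid M k).
Proof.
apply: (@sub_finite_set _ _
  ((fun f : {ffun 'I_s -> {set E}} => f : 'I_s -> {set E}) @` setT)).
  by move=> A _; exists (finfun A) => //; apply/funext => i; rewrite ffunE.
by apply: finite_image; exact: finite_finset.
Qed.

(** Since [A] maximizes every term at once, a maximizer of the weighted sum must match it in each
    term, the weights being positive. *)
Lemma argmax_flag_vector c w A : (forall i, 0 < w i) ->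
  flag_matroid M k A -> (forall i, max_weight M c (A i)) ->
  argmax_at (flag_matroid M k) (flag_vector w) c =
  [set B | flag_matroid M k B /\ forall i, max_weight M c (B i)].
Proof.
move=> w0 FA Amax.
have le_max B C i : flag_matroid M k B -> flag_matroid M k C ->
    max_weight M c (B i) ->
    dot c (indicator_vec (C i)) <= dot c (indicator_vec (B i)).
  move=> [FB _] [FC _] [_ Bmax].
  by apply: Bmax; rewrite ?(FC i).1 // (FC i).2 (FB i).2.
apply/seteqP; split => B /= [FB Bmax]; split => //; last first.
  move=> C FC; rewrite !dot_flag_vector; apply: ler_sum => i _.
  by rewrite ler_pM2l //; exact: le_max.
move=> i.
have d0 j : 0 <= w j * (dot c (indicator_vec (A j)) - dot c (indicator_vec (B j))).
  by rewrite mulr_ge0 ?(ltW (w0 j)) // subr_ge0; exact: le_max.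
have : \sum_j w j * (dot c (indicator_vec (A j)) - dot c (indicator_vec (B j))) == 0.
  rewrite eq_le sumr_ge0 // andbT.
  under eq_bigr do rewrite mulrBr.
  rewrite sumrB subr_le0 -!dot_flag_vector; exact: Bmax.
rewrite psumr_eq0 // => /allP /(_ i (mem_index_enum _)) /=.
rewrite mulf_eq0 gt_eqF //= subr_eq0 => /eqP AB.
split; first exact: (FB.1 i).1.
move=> C CI CB; rewrite -AB; apply: (Amax i).2 => //.
by rewrite CB (FB.1 i).2 (FA.1 i).2.
Qed.

End FlagVectors.

(** * Sections and their integrals *)

Section MonotonePaths.
Context {R : realType} {E : finType}.
Implicit Types (c : E -> R) (P : set (E -> R)) (g : R -> E -> R).

Lemma within_continuous_ptws (D : set R) g :
  {within D, continuous (g : R -> {ptws E -> R})} <->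
  (forall e, {within D, continuous (fun t => g t e)}).
Proof.
split=> [cg e|cg].
  move=> t; apply: (@continuous_comp (subspace D) {ptws E -> R} R g
    (fun f : {ptws E -> R} => f e)); first exact: cg.
  exact: (@proj_continuous E (fun=> R) e).
(* The pointwise topology is the supremum of those induced by the evaluations; each evaluation is
   surjective because of the constant functions. *)
move=> t; apply/cvg_sup => e; rewrite cvg_image; last first.
  by rewrite eqEsubset; split => // u _; exists (fun=> u).
move=> W /= Wn; exists ((fun f : E -> R => f e) @^-1` W).
  exact: (cg e t).
by rewrite eqEsubset; split => [u [f fW <-] //|u Wu]; exists (fun=> u).
Qed.

Lemma section_integrable c P (a b : R) g : dot c @` P = [set` `[a, b]] ->
  is_section c P g -> forall e,
  (@lebesgue_measure R).-integrable `[a, b] (EFin \o (fun t => g t e)).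
Proof.
move=> dP [cg _ _] e; apply: within_continuous_integrable.
by move: e; apply/within_continuous_ptws; rewrite -dP.
Qed.

Lemma dot_section_integral c l P (a b : R) g : dot l @` P = [set` `[a, b]] ->
  is_section l P g ->
  dot c (section_integral l P g) =
  \int[lebesgue_measure]_(t in `[a, b]) dot c (g t).
Proof.
move=> dP gs; rewrite /section_integral dP /dot Rintegral_sum //.
  apply: eq_bigr => e _; rewrite RintegralZl //.
  exact: section_integrable gs e.
move=> e.
have := integrableZl _ (c e) (section_integrable dP gs e).
exact.
Qed.

(** A pointwise convex combination of sections is a section, and integration is linear. *)
Lemma convex_monotone_path_polytope c P (a b : R) : dot c @` P = [set` `[a, b]] ->
  @convex_set R (E -> R) P ->
  @convex_set R (E -> R) (monotone_path_polytope c P).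
Proof.
move=> dP cP; apply/convex_setP => _ _ t [g gs <-] [h hs <-] t01.
exists (fun u => t *: g u + (1 - t) *: h u).
  have [cg gP gd] := gs; have [ch hP hd] := hs.
  split.
  - apply/within_continuous_ptws => e.
    move/within_continuous_ptws : cg => /(_ e) cg.
    move/within_continuous_ptws : ch => /(_ e) ch.
    move=> u; apply: (@cvgD R R^o).
      by apply: (@cvgM R) => //; [exact: cvg_cst|exact: cg].
    by apply: (@cvgM R) => //; [exact: cvg_cst|exact: ch].
  - by move=> u Du; move/convex_setP : cP; apply; [exact: gP|exact: hP|].
  - by move=> u Du; rewrite dotD !dotZ gd // hd //; ring.
apply/funext => e.
have ig := section_integrable dP gs e.
have ih := section_integrable dP hs e.
rewrite /section_integral dP.
change (2 * \int[lebesgue_measure]_(u in `[a, b]) (t * g u e + (1 - t) * h u e) =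
  t * (2 * \int[lebesgue_measure]_(u in `[a, b]) g u e) +
  (1 - t) * (2 * \int[lebesgue_measure]_(u in `[a, b]) h u e)).
rewrite RintegralD //; first last.
- exact: (integrableZl _ (1 - t) ih).
- exact: (integrableZl _ t ig).
by rewrite !RintegralZl //; ring.
Qed.

End MonotonePaths.

(** * The monotone path polytope of the rank-selected polytope *)

Section RankSelected.
Context {R : realType} {E : finType} (M : matroid E) (m : nat)
  (k : 'I_m.+1 -> nat).
Hypothesis m_gt0 : (0 < m)%N.
Hypothesis k_incr : forall i j : 'I_m.+1, (i < j)%N -> (k i < k j)%N.
Hypothesis k_rank : forall i : 'I_m.+1, (k i <= mrank M)%N.
Implicit Types (c x : E -> R) (A B : 'I_m.+1 -> {set E}).

(** Indexed by [nat] to fit the interpolation lemmas; [inord] is faithful for [i <= m]. *)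
Let node (i : nat) : R := (k (inord i))%:R.
Let P : set (E -> R) := rank_selected_polytope M k.
Let flags := flag_matroid M k.

Lemma node_incr i : (i < m)%N -> node i < node i.+1.
Proof.
by move=> im; rewrite ltr_nat; apply: k_incr; rewrite !inordK // ltnS ltnW.
Qed.

Lemma dot_ones_indicator (A : {set E}) :
  dot (@ones R E) (indicator_vec A) = #|A|%:R.
Proof. by rewrite dot_indicator sumr_const. Qed.

(** The last clause is concavity of the greedy weights: each chord, extended beyond its interval,
    bounds the weight at every node. *)
Lemma greedy_flag c : exists A, [/\ flags A, forall i, max_weight M c (A i) &
  forall i j : nat, (i < m)%N -> (j <= m)%N ->
    dot c (indicator_vec (A (inord j))) <=
    chord (node i) (node i.+1) (dot c (indicator_vec (A (inord i))))
      (dot c (indicator_vec (A (inord i.+1)))) (node j)].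
Proof.
have [G [GP GS]] := greedy_chain M c.
have Gsub : forall p q, (p <= q <= mrank M)%N -> G p \subset G q.
  apply: chain_subset => p pr; have [x _ ->] := GS p pr.
  exact: finset.subsetUr.
pose f n := dot c (indicator_vec (G n)).
have fconc n : (n.+2 <= mrank M)%N -> f n.+2 - f n.+1 <= f n.+1 - f n.
  move=> nr; have [x xG Gx] := GS n (ltnW nr); have [y yG Gy] := GS n.+1 nr.
  have [Gn1 [_ Gmax]] := GP n.+1 (ltnW nr).
  have yGn : y \notin G n.
    by apply: contra yG; apply/fintype.subsetP/Gsub; rewrite leqnSn ltnW.
  (* [y |: G n] competes with [G n.+1 = x |: G n], so [c y <= c x]: the increments of [f]
     decrease. *)
  have : dot c (indicator_vec (y |: G n)) <= f n.+1.
    apply: Gmax; last by rewrite cardsU1 yGn (GP n _).1 ?Gn1 // ltnW // ltnW.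
    apply: (indep_sub (GP n.+2 nr).2.1); rewrite Gy.
    by apply: finset.setUS; apply: Gsub; rewrite leqnSn ltnW.
  by rewrite /f Gy !dot_indicatorU1 // -/(f n); lra.
exists (fun i => G (k i)); split.
- split=> [i|i j ij]; first by have [? [? _]] := GP _ (k_rank i).
  by apply: Gsub; rewrite k_rank andbT ltnW // k_incr.
- by move=> i; have [] := GP _ (k_rank i).
move=> i j im jm; rewrite -/(f _) -/(f _) -/(f _) /chord.
have kik : (k (inord i) < k (inord i.+1))%N by have := node_incr im; rewrite ltr_nat.
have d0 : 0 < node i.+1 - node i by rewrite subr_gt0 node_incr.
have le_k a b : (a <= b)%N -> (b <= m)%N -> (k (inord a) <= k (inord b))%N.
  move=> ab bm; have := @nodes_le R m node node_incr a b ab bm.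
  by rewrite ler_nat.
rewrite -subr_ge0 -(pmulr_rge0 _ d0).
have -> : forall u v z : R, (node i.+1 - node i) *
    (u + (v - u) / (node i.+1 - node i) * (node j - node i) - z) =
    (node i.+1 - node i) * (u - z) + (v - u) * (node j - node i).
  by move=> u v z; field; rewrite gt_eqF.
(* No node lies strictly inside the interval, so [concave_slopes] applies to the indices
   [j, i, i.+1] or [i, i.+1, j]. *)
have [ji|ij] := leqP j i.
  have := @concave_slopes R f _ fconc (k (inord j)) (k (inord i)) (k (inord i.+1))
    (le_k _ _ ji (ltnW im)) (ltnW kik) (k_rank _).
  rewrite -/(node _) -/(node _) -/(node _); lra.
have := @concave_slopes R f _ fconc (k (inord i)) (k (inord i.+1)) (k (inord j))
    (ltnW kik) (le_k _ _ ij jm) (k_rank _).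
rewrite -/(node _) -/(node _) -/(node _); lra.
Qed.

Definition flag_path A (t : R) : E -> R :=
  fun e => interpolation m node (fun i => indicator_vec (A (inord i)) e) t.

Lemma flag_path_chord A j t : (j < m)%N -> node j <= t <= node j.+1 ->
  let u := (t - node j) / (node j.+1 - node j) in
  flag_path A t = u *: indicator_vec (A (inord j.+1)) +
    (1 - u) *: indicator_vec (A (inord j)).
Proof.
move=> jm jt u; apply/funext => e; rewrite /flag_path.
rewrite (interpolation_chord node_incr _ jm jt) /chord.
set lhs := (X in X = _).
change (lhs = u * indicator_vec (A (inord j.+1)) e +
  (1 - u) * indicator_vec (A (inord j)) e).
by rewrite /lhs /u; field; rewrite subr_eq0 gt_eqF // node_incr.
Qed.

Lemma polytope_indicator A i : flags A -> P (indicator_vec (A i)).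
Proof.
move=> [FA _]; apply: sub_conv_hull; exists (A i) => //.
by split; [exact: (FA i).1 | exists i; exact: (FA i).2].
Qed.

Lemma flag_path_in A t : flags A -> node 0%N <= t <= node m ->
  P (flag_path A t) /\ dot (@ones R E) (flag_path A t) = t.
Proof.
move=> FA tm; have [j jm jt] := locate_node m_gt0 tm.
have d0 : 0 < node j.+1 - node j by rewrite subr_gt0 node_incr.
rewrite (flag_path_chord A jm jt); split.
  have /convex_setP := @convex_conv_hull R E [set indicator_vec A | A in
    [set A : {set E} | A \in indep M /\ exists i : 'I_m.+1, #|A| = k i]].
  apply; [exact: polytope_indicator|exact: polytope_indicator|].
  case/andP: jt => jt tj; apply/andP; split.
    by apply: divr_ge0; [rewrite subr_ge0|exact: ltW].
  by rewrite ler_pdivrMr // mul1r lerD2r.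
rewrite dotD !dotZ !dot_ones_indicator !(FA.1 _).2 -/(node _) -/(node _).
by field; rewrite gt_eqF.
Qed.

Lemma dot_ones_image : dot (@ones R E) @` P = [set` `[node 0%N, node m]].
Proof.
apply/seteqP; split => t /=.
  move=> [x Px <-]; rewrite in_itv /=; move: x Px.
  apply: (@conv_hull_min _ _ _
    [set x | node 0%N <= dot (@ones R E) x <= node m]).
    apply/convex_setP => x y u /= /andP[x0 xm] /andP[y0 ym] /andP[u0 u1].
    by rewrite dotD !dotZ; apply/andP; split; nra.
  move=> _ [A [AI [i Ai]] <-] /=; rewrite dot_ones_indicator Ai.
  have -> : (k i)%:R = node i by rewrite /node inord_val.
  by rewrite !(nodes_le node_incr) // -ltnS.
(* Any flag would do; the greedy one for the zero function shows that flags exist. *)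
rewrite in_itv /= => tm; have [A [FA _ _]] := greedy_flag 0.
have [Pt tE] := flag_path_in FA tm.
by exists (flag_path A t).
Qed.

Lemma flag_path_section A : flags A -> is_section (@ones R E) P (flag_path A).
Proof.
move=> FA; rewrite /is_section dot_ones_image; split.
- apply/within_continuous_ptws => e; apply: continuous_subspaceT.
  exact: interpolation_continuous.
- by move=> t; rewrite /= in_itv => /(flag_path_in FA)[].
- by move=> t; rewrite /= in_itv => /(flag_path_in FA)[].
Qed.

Let weight (i : 'I_m.+1) : R := node_weight m node i.

Lemma weight_gt0 i : 0 < weight i.
Proof. by apply: (node_weight_gt0 node_incr m_gt0); rewrite -ltnS. Qed.

Lemma flag_path_integral A : flags A ->
  2 *: section_integral (@ones R E) P (flag_path A) = flag_vector weight A.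
Proof.
move=> FA; apply/funext => e.
rewrite /section_integral dot_ones_image.
pose y i : R := indicator_vec (A (inord i)) e.
change (2 * \int[lebesgue_measure]_(t in `[node 0%N, node m])
  interpolation m node y t = flag_vector weight A e).
rewrite (integral_interpolation node_incr) (node_weightE m node y).
rewrite /flag_vector fct_sumE.
by apply: eq_bigr => i _; rewrite /y inord_val.
Qed.

(** Flag paths and convexity give one inclusion. For the other, in each direction [c] a greedy flag
    dominates the integral of a given section, and [conv_hull_separation] concludes. *)
Lemma monotone_path_polytopeE :
  monotone_path_polytope (@ones R E) P = conv_hull (flag_vector weight @` flags).
Proof.
apply/seteqP; split; last first.
  apply: conv_hull_min.
    apply: (convex_monotone_path_polytope dot_ones_image).
    exact: convex_conv_hull.
  move=> _ [A FA <-]; exists (flag_path A); first exact: flag_path_section.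
  exact: flag_path_integral.
move=> _ [g gs <-]; apply: conv_hull_separation.
  by apply: finite_image; exact: finite_flag_matroid.
move=> c; have [A [FA Amax Achord]] := greedy_flag c.
exists (flag_vector weight A); first by exists A.
rewrite dotZ (dot_section_integral c dot_ones_image gs) dot_flag_vector.
pose f i := dot c (indicator_vec (A (inord i))).
have -> : \sum_i weight i * dot c (indicator_vec (A i)) =
          \sum_(i < m.+1) node_weight m node i * f i.
  by apply: eq_bigr => i _; rewrite /f inord_val.
rewrite -node_weightE; apply: (integral_le_nodes node_incr).
  apply: within_continuous_integrable; have [cg _ _] := gs.
  apply: (@continuous_sum R (subspace [set` `[node 0%N, node m]])) => e t.
  move: cg; rewrite dot_ones_image => /within_continuous_ptws /(_ e) cg.
  by apply: (@cvgM R); [exact: cvg_cst|exact: cg].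
move=> j t jm jt.
have tm : (dot (@ones R E) @` P) t.
  rewrite dot_ones_image /= in_itv /=; case/andP: jt => jt tj.
  by rewrite (le_trans _ jt) ?(le_trans tj) // (nodes_le node_incr) // ltnW.
have [_ gP gt] := gs.
rewrite -[t in leRHS](gt t tm); move: (g t) (gP t tm).
(* The extended chord is affine in the coordinate sum, so this inequality cuts out a convex set and
   need only be checked on generators of every size. *)
apply: (@conv_hull_min _ _ _ [set x | dot c x <=
  chord (node j) (node j.+1) (f j) (f j.+1) (dot (@ones R E) x)]).
  apply/convex_setP => x y u /= xle yle /andP[u0 u1].
  rewrite !dotD !dotZ.
  have := lerD (ler_wpM2l u0 xle) (ler_wpM2l (_ : 0 <= 1 - u) yle).
  rewrite subr_ge0 => /(_ u1) /le_trans; apply.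
  by rewrite le_eqVlt; apply/orP; left; apply/eqP; rewrite /chord; ring.
move=> _ [B [BI [i Bi]] <-] /=.
rewrite dot_ones_indicator Bi.
have -> : (k i)%:R = node i by rewrite /node inord_val.
(* [B] weighs at most as much as the greedy set of its size, which lies below the chord. *)
apply: le_trans (Achord j i jm _); last by rewrite -ltnS.
by rewrite inord_val; apply: (Amax i).2 => //; rewrite Bi (FA.1 i).2.
Qed.

Lemma flag_matroid_polytopeE :
  @flag_matroid_polytope R E M m.+1 k = conv_hull (flag_vector (fun=> 1) @` flags).
Proof.
congr conv_hull; congr (_ @` _); apply/funext => A.
by apply: eq_bigr => i _; rewrite scale1r.
Qed.

Lemma normally_equivalent_succ : normally_equivalent
  (monotone_path_polytope (@ones R E) P) (flag_matroid_polytope M k).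
Proof.
rewrite monotone_path_polytopeE flag_matroid_polytopeE.
(* The right-hand side is free of [w], so both weightings have the same maximizing flags. *)
have amax w c : (forall i, 0 < w i) -> argmax_at flags (flag_vector w) c =
    [set B | flags B /\ forall i, max_weight M c (B i)].
  move=> w0; have [A [FA Amax _]] := greedy_flag c.
  exact: argmax_flag_vector FA Amax.
have ne w c : (forall i, 0 < w i) -> argmax_at flags (flag_vector w) c !=set0.
  move=> w0; rewrite amax //; have [A [FA Amax _]] := greedy_flag c.
  by exists A.
have fin w : finite_set (flag_vector w @` flags : set (E -> R)).
  by apply: finite_image; exact: finite_flag_matroid.
split; [by exists (flag_vector weight @` flags)| |].
  by exists (flag_vector (fun=> 1) @` flags).
have w1 (i : 'I_m.+1) : 0 < 1 :> R by [].
rewrite !normal_fan_conv_hull => [|c|c]; last 2 first.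
- exact: ne.
- exact/ne/weight_gt0.
congr (_ @` _); apply/funext => c.
apply/seteqP; split => c' /=; rewrite !amax //; exact: weight_gt0.
Qed.

End RankSelected.

Theorem theorem5p3 (R : realType) (E : finType) (M : matroid E)
    (s : nat) (k : 'I_s -> nat)
    (hs : (2 <= s)%N)
    (k_incr : forall i j : 'I_s, (i < j)%N -> (k i < k j)%N)
    (k_rank : forall i : 'I_s, (k i <= mrank M)%N) :
  normally_equivalent
    (monotone_path_polytope (@ones R E) (rank_selected_polytope M k))
    (flag_matroid_polytope M k).
Proof.
(* With [s = m.+1], the bound [2 <= s] computes to [0 < m], where [m] counts the intervals between
   consecutive nodes. *)
case: s k hs k_incr k_rank => // m k m_gt0 k_incr k_rank.
exact: normally_equivalent_succ.
Qed.
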